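(* Let $G_1, G_2, G_3$ be three directed graphs on a common set of $n$ vertices. If $e(G_i)+e(G_j)\geq\frac{10}{9}n^2$ for all $1 \leq i < j \leq 3$, then there exists a rainbow directed triangle.
   Context: A directed graph $G$ consists of a vertex set $V(G)$ and an edge set $E(G)$ of ordered pairs of distinct vertices (no loops, no multiple edges; both $(u,v)$ and $(v,u)$ may be present). $e(G)=|E(G)|$. The edges of $G_i$ are thought of as having color $i$. A rainbow directed triangle is a triple of distinct vertices $u,v,w$ together with pairwise distinct colors $a,b,d\in\{1,2,3\}$ such that $(u,v)\in E(G_a)$, $(v,w)\in E(G_b)$, $(w,u)\in E(G_d)$. *)

(* Defs.v *)
From mathcomp Require Import all_boot all_order all_algebra.

Set Implicit Arguments.
Unset Strict Implicit.
Unset Printing Implicit Defensive.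

Record digraph (V : finType) := Digraph {
  edges : {set V * V};
  edges_loopless : forall v : V, (v, v) \notin edges
}.

Definition num_edges (V : finType) (G : digraph V) : nat := #|edges G|.

(* The colors 1, 2, 3 are the elements 0, 1, 2 of 'I_3. *)
Definition rainbow_directed_triangle (V : finType) (G : 'I_3 -> digraph V)
    (u v w : V) (a b d : 'I_3) : Prop :=
  [/\ [/\ u <> v, v <> w & w <> u],
      [/\ a <> b, b <> d & d <> a] &
      [/\ (u, v) \in edges (G a), (v, w) \in edges (G b)
        & (w, u) \in edges (G d)]].

(* Main.v *)
Require Import Defs.
From mathcomp Require Import all_boot all_order all_algebra.
From mathcomp Require Import all_fingroup zify ring lra.

Set Implicit Arguments.
Unset Strict Implicit.
Unset Printing Implicit Defensive.
Import Order.TTheory GRing.Theory Num.Theory.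

(** Write D_k for a part of the vertex set covered by disjoint directed
    circuits all of whose arcs carry both colours other than k.  If u -> v is
    such an arc, then for every z the pairs (v, z) and (z, u) together
    contribute at most 2 to each of the two pair sums e(G_i) + e(G_j) with
    k in {i, j}; summing along a circuit, D_k exceeds the trivial density
    only in the pair sum avoiding k.  Choose D_0, D_1, D_2 disjoint with the
    largest union and let R be the rest.  No vertex of R can be inserted into
    a circuit, which bounds the excess between D_k and R, and R contains no
    further circuit, which makes R locally sparse: a Turan-type argument gives
    at most (r^2 - r) + 2 r^2 / 3 coloured edges inside R, where r = |R|.
    With d_k = |D_k| and n = d_0 + d_1 + d_2 + r, up to lower order terms,

    - e(G_i) + e(G_j) <= n^2 + d_k^2 + d_k r + r^2 / 2,
    - any two pair sums add up to at most
      2 n^2 + d_i^2 + d_j^2 + (d_i + d_j) r + 2 r^2 / 3,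
    - the three pair sums add up to at most 3 n^2 + sum d_k^2 + r^2 / 3.

    These are incompatible with every pair sum being at least 10 n^2 / 9; the
    extremal configuration is r = 0 and d_0 = d_1 = d_2 = n / 3. *)

(** * Colour sets on ordered pairs, and their local constraints *)

(* The set of colours carried by an ordered pair of vertices. *)
Definition cell := (bool * bool * bool)%type.
Definition has_color (k : nat) (X : cell) : bool :=
  match k with 0 => X.1.1 | 1 => X.1.2 | _ => X.2 end.
Definition csize (X : cell) : nat := X.1.1 + X.1.2 + X.2.
(* Summed over all ordered pairs, [csize_but k] gives e(G_i) + e(G_j) for {i, j, k} = {0, 1, 2}. *)
Definition csize_but (k : nat) (X : cell) : nat := csize X - has_color k X.
(** The colour [k] itself may or may not be present. *)
Definition full (k : nat) (X : cell) : bool := csize_but k X == 2.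
Definition rb_free (X Y Z : cell) : bool :=
  ~~ [|| [&& X.1.1, Y.1.2 & Z.2], [&& X.1.1, Y.2 & Z.1.2],
         [&& X.1.2, Y.1.1 & Z.2], [&& X.1.2, Y.2 & Z.1.1],
         [&& X.2, Y.1.1 & Z.1.2] | [&& X.2, Y.1.2 & Z.1.1]].

(* Quantifiers over cells and colours that compute, for exhaustive checks by [vm_compute]. *)
Definition all_bool (P : bool -> bool) : bool := P true && P false.
Definition all_cell (P : cell -> bool) : bool :=
  all_bool (fun a => all_bool (fun b => all_bool (fun c => P (a, b, c)))).

Lemma all_cellP P : all_cell P -> forall X, P X.
Proof.
have bP Q : all_bool Q -> forall b, Q b by case/andP=> ? ? [].
by move=> allP [[a b] c]; apply: (bP _ (bP _ (bP _ allP a) b) c).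
Qed.

Definition all_color (P : nat -> bool) : bool := [&& P 0, P 1 & P 2].

Lemma all_colorP P : all_color P -> forall k : 'I_3, P k.
Proof. by case/and3P=> ? ? ? [[|[|[|//]]] ?]. Qed.

Lemma all_colorI (P : nat -> bool) : (forall k : 'I_3, P k) -> all_color P.
Proof.
by move=> allP; rewrite /all_color (allP ord0) (allP (lift ord0 ord0)) (allP ord_max).
Qed.

(** Since [X] carries both colours other than [k], a colour [k] in one of [Y], [Z] forbids every
    colour but [k] in the other. So if [k] is in both, each is just [{k}]; if it is in exactly one,
    the other is empty; if it is in neither, each has at most one colour besides [l]. *)
Lemma full_arc (k : 'I_3) (X Y Z : cell) : rb_free X Y Z -> full k X ->
  (forall l : 'I_3, l != k -> csize_but l Y + csize_but l Z <= 2)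
  /\ csize Y + csize Z <= full k Y + full k Z + 2.
Proof.
pose chk (k : nat) X Y Z := if rb_free X Y Z then
  if full k X then all_color (fun l => (l == k) || (csize_but l Y + csize_but l Z <= 2))
   && (csize Y + csize Z <= full k Y + full k Z + 2) else true else true.
have: all_color (fun k => all_cell (fun X => all_cell (fun Y => all_cell (chk k X Y)))) by vm_compute.
move/all_colorP/(_ k)/all_cellP/(_ X)/all_cellP/(_ Y)/all_cellP/(_ Z).
rewrite /chk => + rXYZ fX; rewrite rXYZ fX => /andP[/all_colorP lP ->]; split=> // l nlk.
by have := lP l; rewrite val_eqE (negPf nlk).
Qed.

(** The excess over one colour per ordered pair. Truncation is harmless for upper bounds, as
    [csize X + csize Y <= weight X Y + 2] still holds. *)
Definition weight (X Y : cell) : nat := csize X + csize Y - 2.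
Definition no_digon (X Y : cell) : bool := all_color (fun k => ~~ (full k X && full k Y)).
Definition no_circuit (X Y Z : cell) : bool :=
  all_color (fun k => ~~ [&& full k X, full k Y & full k Z]).

(** With five colours on a pair, one direction carries all three and the other at least two, which
    is a digon. *)
Lemma weight_le2 X Y : no_digon X Y -> weight X Y <= 2.
Proof.
by apply/implyP; move: Y; apply: all_cellP; move: X; apply: all_cellP; vm_compute.
Qed.

Definition full_cell : cell := (true, true, true).

(* For vertices a, b, c the cells are those of ab, ba, bc, cb, ca, ac in this
   order: a path of two pairs of weight 2 can only be closed by a pair of
   positive weight when it is transitively oriented. *)
Lemma weight2_path X X' Y Y' Z Z' (f := full_cell) :
  rb_free X Y Z -> rb_free X' Z' Y' -> no_circuit X Y Z -> no_circuit X' Z' Y' ->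
  no_digon X X' -> no_digon Y Y' -> no_digon Z Z' ->
  weight X X' = 2 -> weight Y Y' = 2 ->
  [\/ weight Z Z' = 0,
      weight Z Z' = 1 /\ [/\ X = f, Y = f, Z' = f & (X' != f) && (Y' != f)] |
      weight Z Z' = 1 /\ [/\ X' = f, Y' = f, Z = f & (X != f) && (Y != f)]].
Proof.
pose chk X X' Y Y' Z Z' :=
  if [&& no_digon Z Z', rb_free X Y Z, rb_free X' Z' Y', no_circuit X Y Z
       & no_circuit X' Z' Y'] then
    [|| weight Z Z' == 0,
        (weight Z Z' == 1) && [&& X == f, Y == f, Z' == f, X' != f & Y' != f]
      | (weight Z Z' == 1) && [&& X' == f, Y' == f, Z == f, X != f & Y != f]]
  else true.
pose heavy X Y := (weight X Y == 2) && no_digon X Y.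
have: all_cell (fun X => all_cell (fun X' => if heavy X X' then
    all_cell (fun Y => all_cell (fun Y' => if heavy Y Y' then
      all_cell (fun Z => all_cell (fun Z' => chk X X' Y Y' Z Z'))
    else true)) else true)) by vm_compute.
move/all_cellP/(_ X)/all_cellP/(_ X') => + r1 r2 c1 c2 n1 n2 n3 w1 w2.
rewrite {1}/heavy w1 n1 eqxx => /all_cellP/(_ Y)/all_cellP/(_ Y').
rewrite /heavy w2 n2 eqxx => /all_cellP/(_ Z)/all_cellP/(_ Z').
rewrite /chk n3 r1 r2 c1 c2 /=.
case/or3P=> [/eqP ->|/andP[/eqP ->]|/andP[/eqP ->]]; first by constructor 1.
- by case/and4P=> /eqP -> /eqP -> /eqP -> ->; constructor 2.
- by case/and4P=> /eqP -> /eqP -> /eqP -> ->; constructor 3.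
Qed.

(** * A Turan-type bound for weighted graphs *)

Lemma sum_setD1 (V : finType) (A : {set V}) (x : V) (f : V -> nat) :
  x \in A -> \sum_(u in A) f u = f x + \sum_(u in A :\ x) f u.
Proof. exact: big_setD1. Qed.

Lemma sum_pairs_setD1 (V : finType) (w : V -> V -> nat) (A : {set V}) (x : V) :
  (forall u v, w u v = w v u) -> w x x = 0 -> x \in A ->
  \sum_(u in A) \sum_(v in A) w u v =
  \sum_(u in A :\ x) \sum_(v in A :\ x) w u v + 2 * \sum_(v in A :\ x) w x v.
Proof.
move=> wC wxx Ax; rewrite (sum_setD1 _ Ax) (sum_setD1 (w x) Ax) wxx add0n.
have -> : \sum_(u in A :\ x) \sum_(v in A) w u v =
    \sum_(u in A :\ x) (w x u + \sum_(v in A :\ x) w u v).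
  by apply: eq_bigr => u _; rewrite (sum_setD1 (w u) Ax) wC.
by rewrite big_split /=; lia.
Qed.

Lemma sum_leq_const (V : finType) (A : {set V}) (f : V -> nat) (c : nat) :
  (forall v, v \in A -> f v <= c) -> \sum_(v in A) f v <= c * #|A|.
Proof. by move=> fc; rewrite mulnC -sum_nat_const; apply: leq_sum. Qed.

(* Delete three vertices spanning weights 2, 2, 1, to which every other vertex
   sends weight at most 4, or else the ends of a pair of weight 2, to which
   every other vertex then sends weight at most 2. *)
Lemma weighted_turan (V : finType) (w : V -> V -> nat) (A : {set V}) :
  (forall u v, w u v = w v u) -> (forall v, w v v = 0) ->
  {in A &, forall u v, w u v <= 2} ->
  {in A & &, forall a b c, w a b = 2 -> w b c = 2 -> w a c <= 1} ->
  (forall a b c z, a \in A -> b \in A -> c \in A -> z \in A ->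
     w a b = 2 -> w b c = 2 -> w c z = 2 -> w z a = 2 ->
     w a c = 1 -> w b z = 1 -> False) ->
  3 * \sum_(u in A) \sum_(v in A) w u v <= 4 * #|A| ^ 2.
Proof.
move=> wC w0; have [n] := ubnP #|A|; elim: n A => // n IHn A leAn w2 tri sqr.
have IH (B : {set V}) : {subset B <= A} -> #|B| < #|A| ->
    3 * \sum_(u in B) \sum_(v in B) w u v <= 4 * #|B| ^ 2.
  move=> sBA ltBA; apply: IHn; first by lia.
  - by move=> u v /sBA Au /sBA Av; apply: w2.
  - by move=> a b c /sBA Aa /sBA Ab /sBA Ac; apply: tri.
  - by move=> a b c z /sBA Aa /sBA Ab /sBA Ac /sBA Az; apply: sqr.
have [/existsP[a /existsP[b /existsP[c /and5P[Aa Ab Ac /eqP wab /andP[/eqP wbc /eqP wac]]]]]|nopath] :=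
  boolP [exists a, exists b, exists c,
   [&& a \in A, b \in A, c \in A, w a b == 2 & (w b c == 2) && (w a c == 1)]].
  have nab : b != a by apply: contra_eqN wab => /eqP ->; rewrite w0.
  have nbc : c != b by apply: contra_eqN wbc => /eqP ->; rewrite w0.
  have nac : c != a by apply: contra_eqN wac => /eqP ->; rewrite w0.
  have Ab1 : b \in A :\ a by rewrite !inE nab.
  have Ac2 : c \in A :\ a :\ b by rewrite !inE nbc nac.
  rewrite (sum_pairs_setD1 wC (w0 a) Aa) (sum_pairs_setD1 wC (w0 b) Ab1).
  rewrite (sum_pairs_setD1 wC (w0 c) Ac2).
  have cA := cardsD1 a A; have cA1 := cardsD1 b (A :\ a).
  have cA2 := cardsD1 c (A :\ a :\ b); rewrite Aa Ab1 Ac2 /= in cA cA1 cA2.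
  rewrite (sum_setD1 _ Ab1) (sum_setD1 _ Ac2) (sum_setD1 _ Ac2) /= wab wbc wac.
  set B := A :\ a :\ b :\ c in cA2 *.
  have sBA : {subset B <= A} by move=> u; rewrite !inE; do !case/andP=> _.
  have IHB : 3 * \sum_(u in B) \sum_(v in B) w u v <= 4 * #|B| ^ 2.
    by apply: IH => //; lia.
  (* Weight 5 from [z] needs two weights 2 and a third of at least 1. By [tri] the two cannot go to
     [a, b] or to [b, c]; if they go to [a, c], then [w b z = 1] and [sqr] applies. *)
  have : \sum_(z in B) (w a z + w b z + w c z) <= 4 * #|B|.
    apply: sum_leq_const => z Bz; have Az := sBA z Bz.
    have := tri _ _ _ Az Aa Ab; have := tri _ _ _ Az Ab Ac.
    have := tri _ _ _ Az Ab Aa; have := tri _ _ _ Az Ac Ab.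
    have := w2 _ _ Aa Az; have := w2 _ _ Ab Az; have := w2 _ _ Ac Az.
    have := sqr _ _ _ _ Aa Ab Ac Az wab wbc.
    rewrite (wC b a) (wC c b) (wC z a) (wC z b) (wC z c) wab wbc wac.
    by lia.
  by rewrite !big_split /=; move: IHB; rewrite !expnS !expn0; nia.
have [/existsP[a /existsP[b /and3P[Aa Ab /eqP wab]]]|nored] :=
  boolP [exists a, exists b, [&& a \in A, b \in A & w a b == 2]].
  have nab : b != a by apply: contra_eqN wab => /eqP ->; rewrite w0.
  have Ab1 : b \in A :\ a by rewrite !inE nab.
  rewrite (sum_pairs_setD1 wC (w0 a) Aa) (sum_pairs_setD1 wC (w0 b) Ab1).
  have cA := cardsD1 a A; have cA1 := cardsD1 b (A :\ a).
  rewrite Aa Ab1 /= in cA cA1.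
  rewrite (sum_setD1 _ Ab1) /= wab.
  set B := A :\ a :\ b in cA1 *.
  have sBA : {subset B <= A} by move=> u; rewrite !inE; do !case/andP=> _.
  have IHB : 3 * \sum_(u in B) \sum_(v in B) w u v <= 4 * #|B| ^ 2.
    by apply: IH => //; lia.
  (* Weight 3 from [z] would be 2 and 1 by [tri], hence a path of the kind excluded by [nopath]. *)
  have : \sum_(z in B) (w a z + w b z) <= 2 * #|B|.
    apply: sum_leq_const => z Bz; have Az := sBA z Bz.
    have nopath3 x y t : x \in A -> y \in A -> t \in A ->
        w x y = 2 -> w y t = 2 -> w x t <> 1.
      move=> Ax Ay At wxy wyt wxt; case/negP: nopath.
      apply/existsP; exists x; apply/existsP; exists y; apply/existsP; exists t.
      by rewrite Ax Ay At wxy wyt wxt.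
    have := tri _ _ _ Az Aa Ab; have := tri _ _ _ Az Ab Aa.
    have := nopath3 _ _ _ Az Aa Ab; have := nopath3 _ _ _ Az Ab Aa.
    have := w2 _ _ Aa Az; have := w2 _ _ Ab Az.
    rewrite (wC b a) (wC z a) (wC z b) wab.
    by lia.
  by rewrite !big_split /=; move: IHB; rewrite !expnS !expn0; nia.
have : \sum_(u in A) \sum_(v in A) w u v <= #|A| * #|A|.
  apply: sum_leq_const => u Au; rewrite -[#|A|]mul1n; apply: sum_leq_const => v Av.
  have := w2 _ _ Au Av; rewrite leq_eqVlt => /orP[/eqP wuv|//].
  by case/negP: nored; apply/existsP; exists u; apply/existsP; exists v; rewrite Au Av wuv.
by rewrite !expnS !expn0; nia.
Qed.

(** * Maximal covers by monochromatically deficient circuits *)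

Definition rainbow_free (V : finType) (F : V -> V -> cell) : Prop :=
  (forall v, F v v = (false, false, false)) /\
  (forall u v w, rb_free (F u v) (F v w) (F w u)).

(* The nontrivial orbits of D.1 are the circuits; D.2 gives the colour missing
   from the arcs of the circuit through a vertex, and None off the circuits. *)
Definition circuit_cover (V : finType) (F : V -> V -> cell)
    (D : {perm V} * {ffun V -> option 'I_3}) : bool :=
  [forall v, if D.2 v is Some k then (D.2 (D.1 v) == Some k) && full k (F v (D.1 v))
             else D.1 v == v].

Definition part (V : finType) (c : {ffun V -> option 'I_3}) (p : option 'I_3) : {set V} :=
  [set v | c v == p].

Definition maximal_cover (V : finType) (F : V -> V -> cell) D : Prop :=
  circuit_cover F D /\
  forall D', circuit_cover F D' -> #|part D.2 None| <= #|part D'.2 None|.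

Lemma maximal_cover_exists (V : finType) (F : V -> V -> cell) : exists D, maximal_cover F D.
Proof.
pose D0 : {perm V} * {ffun V -> option 'I_3} := (1%g, [ffun => None]).
have cD0 : circuit_cover F D0 by apply/forallP => v; rewrite /= ffunE perm1.
by case: (arg_minnP (fun D => #|part D.2 None|) cD0) => D cD minD; exists D.
Qed.

Lemma cover_perm (V : finType) (F : V -> V -> cell) (s : {perm V}) c (v : V) :
  circuit_cover F (s, c) -> c (s v) = c v.
Proof.
move=> /forallP/(_ v) /=.
by case cv: (c v) => [k|] => [/andP[/eqP csv _]|/eqP sv]; rewrite ?sv.
Qed.

Lemma cover_full (V : finType) (F : V -> V -> cell) (s : {perm V}) c (v : V) k :
  circuit_cover F (s, c) -> c v = Some k -> full k (F v (s v)).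
Proof. by move=> /forallP/(_ v) /= + cv; rewrite cv => /andP[]. Qed.

Lemma cover_fix (V : finType) (F : V -> V -> cell) (s : {perm V}) c (v : V) :
  circuit_cover F (s, c) -> c v = None -> s v = v.
Proof. by move=> /forallP/(_ v) /= + cv; rewrite cv => /eqP. Qed.

(** The uncovered set of the new cover lies inside the old one and misses [z]. *)
Lemma no_better_cover (V : finType) (F : V -> V -> cell) (s : {perm V}) c (s' : {perm V})
    (c' : {ffun V -> option 'I_3}) (z : V) :
  maximal_cover F (s, c) -> circuit_cover F (s', c') -> c z = None -> c' z != None ->
  (forall v, c v != None -> c' v != None) -> False.
Proof.
case=> _ /[apply] /= + cz c'z sub; apply/negP; rewrite -ltnNge.
apply: proper_card; apply/properP; split; last first.
  by exists z; rewrite !inE ?cz ?eqxx // (negPf c'z).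
by apply/subsetP => v; rewrite !inE; apply: contraTT => /sub /negPf ->.
Qed.

(** Otherwise [s * tperm z (s v)], which sends [v] to [z] and [z] to [s v], would insert [z] into
    the circuit through [v]. *)
Lemma no_insertion (V : finType) (F : V -> V -> cell) (s : {perm V}) c (v z : V) k :
  maximal_cover F (s, c) ->
  c z = None -> c v = Some k -> ~~ (full k (F v z) && full k (F z (s v))).
Proof.
move=> maxD cz cv; have [cov _] := maxD; apply/negP => /andP[fvz fzv].
have csv := cover_perm v cov; rewrite cv in csv.
have sz := cover_fix cov cz.
apply: (@no_better_cover _ _ _ _ (s * tperm z (s v))%g
  [ffun x => if x == z then Some k else c x] z maxD) => //.
- apply/forallP => x /=; rewrite !ffunE permM.
  have [->|nxz] := eqVneq x z.
    by rewrite sz tpermL fzv andbT csv; case: ifP.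
  have [->|nxv] := eqVneq x v; first by rewrite cv tpermR !eqxx.
  have nsz : s x != z by rewrite -[z in _ != z]sz (inj_eq perm_inj).
  have nsv : s x != s v by rewrite (inj_eq perm_inj).
  rewrite tpermD 1?[_ == s x]eq_sym // (negPf nsz).
  case cx: (c x) => [l|]; last by rewrite (cover_fix cov).
  by rewrite (cover_perm _ cov) cx eqxx (cover_full cov).
- by rewrite ffunE eqxx.
- by move=> x; rewrite ffunE; case: (x =P z).
Qed.

(** The support of [t] is uncovered, hence disjoint from that of [s], so [s * t] is a cover having
    the circuits of both. *)
Lemma no_new_circuit (V : finType) (F : V -> V -> cell) (s : {perm V}) c (t : {perm V}) z
    (k : 'I_3) :
  maximal_cover F (s, c) ->
  t z != z -> (forall v, t v != v -> c v = None /\ full k (F v (t v))) -> False.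
Proof.
move=> maxD tz newt; have [cov _] := maxD.
apply: (@no_better_cover _ _ _ _ (s * t)%g
  [ffun x => if t x != x then Some k else c x] z maxD) => //.
- apply/forallP => x /=; rewrite !ffunE permM.
  have [tx|] := eqVneq (t x) x; last first.
    move=> tx; have [cx fx] := newt x tx.
    by rewrite (cover_fix cov cx) (inj_eq perm_inj) tx /= eqxx fx.
  (* If [t] moved [s x], then [s x], and with it [x], would be uncovered; then [s x = x], which [t]
     fixes. *)
  have tsx : t (s x) = s x.
    apply/eqP/negPn/negP => ntsx; have [csx _] := newt _ ntsx.
    by move: ntsx; rewrite (cover_perm _ cov) in csx; rewrite (cover_fix cov csx) tx eqxx.
  rewrite !tsx eqxx /= (cover_perm _ cov).
  case cx: (c x) => [l|]; last by rewrite (cover_fix cov).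
  by rewrite eqxx (cover_full cov).
- by have [] := newt z tz.
- by rewrite ffunE tz.
- by move=> x; rewrite ffunE; case: ifP.
Qed.

Lemma rest_no_digon (V : finType) (F : V -> V -> cell) (s : {perm V}) c (u v : V) :
  maximal_cover F (s, c) ->
  c u = None -> c v = None -> u != v -> no_digon (F u v) (F v u).
Proof.
move=> maxD cu cv nuv; apply: all_colorI => k; apply/negP => /andP[fuv fvu].
apply: (@no_new_circuit _ _ _ _ (tperm u v) u k maxD); first by rewrite tpermL eq_sym.
by move=> x; case: tpermP => [->|->|]; rewrite ?eqxx.
Qed.

Lemma rest_no_circuit (V : finType) (F : V -> V -> cell) (s : {perm V}) c (u v w : V) :
  maximal_cover F (s, c) ->
  c u = None -> c v = None -> c w = None -> u != v -> v != w -> w != u ->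
  no_circuit (F u v) (F v w) (F w u).
Proof.
move=> maxD cu cv cw nuv nvw nwu; apply: all_colorI => k.
apply/negP => /and3P[fuv fvw fwu].
(* The 3-cycle [u -> v -> w -> u]. *)
pose t := (tperm u v * tperm u w)%g.
have tu : t u = v by rewrite permM tpermL tpermD // 1?eq_sym.
have tv : t v = w by rewrite permM tpermR tpermL.
have tw : t w = u by rewrite permM (@tpermD _ u v w) // 1?eq_sym // tpermR.
apply: (@no_new_circuit _ _ _ _ t u k maxD); first by rewrite tu eq_sym.
move=> x; have [->|nxu] := eqVneq x u; first by rewrite tu.
have [->|nxv] := eqVneq x v; first by rewrite tv.
have [->|nxw] := eqVneq x w; first by rewrite tw.
by rewrite permM !tpermD 1?eq_sym // ?eqxx.
Qed.

(** * Sums over parts and identities for colour counts *)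

Lemma sum_part (V : finType) (c : {ffun V -> option 'I_3}) (f : V -> nat) :
  \sum_v f v = \sum_p \sum_(v in part c p) f v.
Proof.
rewrite (partition_big c xpredT) //=; apply: eq_bigr => p _.
by apply: eq_bigl => v; rewrite inE.
Qed.

Lemma sum_option_color (f : option 'I_3 -> nat) (i j k : 'I_3) :
  i != j -> j != k -> k != i ->
  \sum_p f p = f None + f (Some i) + f (Some j) + f (Some k).
Proof.
move=> nij njk nki.
rewrite (bigD1 None) // (bigD1 (Some i)) // (bigD1 (Some j)) /=; last first.
  by apply/eqP => -[e]; rewrite e eqxx in nij.
rewrite (bigD1 (Some k)) /=; last first.
  by apply/andP; split; apply/eqP => -[e]; rewrite e eqxx in nki njk.
rewrite big1 ?addn0 ?addnA // => -[l|//] /=.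
rewrite !(inj_eq (@Some_inj _)); move: i j k l nij njk nki.
by do 4!case=> [[|[|[|//]]] ?].
Qed.

Lemma csize_but_le (k : 'I_3) X : csize_but k X <= full k X + 1.
Proof.
have: all_color (fun k => all_cell (fun X => csize_but k X <= full k X + 1)) by vm_compute.
by move/all_colorP/(_ k)/all_cellP/(_ X).
Qed.

(** Only the third colour is counted twice on the left. *)
Lemma csize_but_add_le (i j : 'I_3) X : i != j -> csize_but i X + csize_but j X <= csize X + 1.
Proof.
move=> nij.
have: all_color (fun i => all_color (fun j => all_cell (fun X =>
  (i == j) || (csize_but i X + csize_but j X <= csize X + 1)))) by vm_compute.
move/all_colorP/(_ i)/all_colorP/(_ j)/all_cellP/(_ X).
by case/orP => [/eqP e|//]; case/eqP: nij; exact: val_inj.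
Qed.

Lemma csize_but_sum (i j k : 'I_3) X : i != j -> j != k -> k != i ->
  csize_but i X + csize_but j X + csize_but k X = 2 * csize X.
Proof.
move=> nij njk nki.
have: all_color (fun i => all_color (fun j => all_color (fun k => all_cell (fun X =>
  [|| i == j, j == k, k == i | csize_but i X + csize_but j X + csize_but k X == 2 * csize X]))))
  by vm_compute.
move/all_colorP/(_ i)/all_colorP/(_ j)/all_colorP/(_ k)/all_cellP/(_ X).
case/or4P => /eqP e //; [case/eqP: nij|case/eqP: njk|case/eqP: nki]; exact: val_inj.
Qed.

Lemma csize_but_has (i j k : 'I_3) X : i != j -> j != k -> k != i ->
  csize_but k X = has_color i X + has_color j X.
Proof.
move=> nij njk nki.
have: all_color (fun i => all_color (fun j => all_color (fun k => all_cell (fun X =>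
  [|| i == j, j == k, k == i | csize_but k X == has_color i X + has_color j X]))))
  by vm_compute.
move/all_colorP/(_ i)/all_colorP/(_ j)/all_colorP/(_ k)/all_cellP/(_ X).
case/or4P => /eqP e //; [case/eqP: nij|case/eqP: njk|case/eqP: nki]; exact: val_inj.
Qed.

Lemma no_digon_le3 (k : 'I_3) X Y : no_digon X Y -> csize_but k X + csize_but k Y <= 3.
Proof.
have: all_color (fun k => all_cell (fun X => all_cell (fun Y => no_digon X Y ==>
  (csize_but k X + csize_but k Y <= 3)))) by vm_compute.
by move/all_colorP/(_ k)/all_cellP/(_ X)/all_cellP/(_ Y)/implyP.
Qed.

(** * Densities between the parts *)

(** Both directions are counted, so [cross F g P P] is twice the sum over ordered pairs in [P]; this
    matches the factor 2 in [cross_total]. *)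
Definition cross (V : finType) (F : V -> V -> cell) (g : cell -> nat) (P Q : {set V}) : nat :=
  \sum_(u in P) \sum_(v in Q) (g (F u v) + g (F v u)).

Lemma crossC (V : finType) (F : V -> V -> cell) g (P Q : {set V}) :
  cross F g P Q = cross F g Q P.
Proof.
rewrite /cross exchange_big; apply: eq_bigr => v _.
by apply: eq_bigr => u _; rewrite addnC.
Qed.

Lemma cross_le (V : finType) (F : V -> V -> cell) g (P Q : {set V}) n :
  (forall z, z \in Q -> \sum_(v in P) (g (F v z) + g (F z v)) <= n * #|P|) ->
  cross F g P Q <= n * (#|P| * #|Q|).
Proof.
move=> le; rewrite crossC mulnA; apply: sum_leq_const => z Qz.
by rewrite (eq_bigr (fun v => g (F v z) + g (F z v))) ?le // => v _; rewrite addnC.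
Qed.

Lemma cross_total (V : finType) (F : V -> V -> cell) g (c : {ffun V -> option 'I_3}) :
  2 * (\sum_u \sum_v g (F u v)) = \sum_p \sum_q cross F g (part c p) (part c q).
Proof.
rewrite mul2n -addnn {2}exchange_big -big_split /= (sum_part c).
apply: eq_bigr => p _; rewrite exchange_big /=; apply: eq_bigr => u _.
by rewrite -big_split /= (sum_part c).
Qed.

(** Shifting one of two sums along the circuits chooses which arcs at [z] are compared. *)
Lemma sum_block_perm (V : finType) (F : V -> V -> cell) (s : {perm V}) c k (g : V -> nat) :
  circuit_cover F (s, c) ->
  \sum_(v in part c (Some k)) g (s v) = \sum_(v in part c (Some k)) g v.
Proof.
move=> cov; rewrite [RHS](reindex_inj (@perm_inj _ s)) /=.
by apply: eq_bigl => v; rewrite !inE (cover_perm _ cov).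
Qed.

Lemma cross_block_other (V : finType) (F : V -> V -> cell) (s : {perm V}) c
    (k l : 'I_3) (Q : {set V}) :
  rainbow_free F -> circuit_cover F (s, c) -> l != k ->
  cross F (csize_but l) (part c (Some k)) Q <= 2 * (#|part c (Some k)| * #|Q|).
Proof.
move=> [_ rbF] cov nlk; apply: cross_le => z _.
(* The arc [s v -> z] is paired with [z -> v], closing the triangle on the full arc [v -> s v]. *)
rewrite big_split /= -(sum_block_perm k (fun v => csize_but l (F v z)) cov) -big_split /=.
apply: sum_leq_const => v; rewrite inE => /eqP cv.
by have [/(_ l nlk)] := full_arc (rbF v (s v) z) (cover_full cov cv).
Qed.

(** Here [v -> z] is paired with [z -> s v]: these two arcs would insert [z] after [v], so at most
    one of them is full. *)
Lemma sum_full_rest (V : finType) (F : V -> V -> cell) (s : {perm V}) c (k : 'I_3) (z : V) :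
  maximal_cover F (s, c) -> c z = None ->
  \sum_(v in part c (Some k)) (full k (F v z) + full k (F z v)) <= #|part c (Some k)|.
Proof.
move=> maxD cz; have [cov _] := maxD.
rewrite big_split /= -(sum_block_perm k (fun v => full k (F z v) : nat) cov) -big_split /=.
rewrite -[leqRHS]mul1n; apply: sum_leq_const => v; rewrite inE => /eqP cv.
by have := no_insertion maxD cz cv; do 2!case: full.
Qed.

Lemma cross_block_rest (V : finType) (F : V -> V -> cell) (s : {perm V}) c (k : 'I_3) :
  maximal_cover F (s, c) ->
  cross F (csize_but k) (part c (Some k)) (part c None)
    <= 3 * (#|part c (Some k)| * #|part c None|).
Proof.
move=> maxD; apply: cross_le => z; rewrite inE => /eqP cz.
have := sum_full_rest k maxD cz.
have : \sum_(v in part c (Some k)) (csize_but k (F v z) + csize_but k (F z v)) <=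
    \sum_(v in part c (Some k)) ((full k (F v z) + full k (F z v)) + 2).
  by apply: leq_sum => v _; have := csize_but_le k (F v z); have := csize_but_le k (F z v); lia.
by rewrite [leqRHS]big_split /= sum_nat_const; lia.
Qed.

Lemma cross_block_rest_size (V : finType) (F : V -> V -> cell) (s : {perm V}) c (k : 'I_3) :
  rainbow_free F -> maximal_cover F (s, c) ->
  cross F csize (part c (Some k)) (part c None)
    <= 3 * (#|part c (Some k)| * #|part c None|).
Proof.
move=> [_ rbF] maxD; have [cov _] := maxD; apply: cross_le => z; rewrite inE => /eqP cz.
have := sum_full_rest k maxD cz.
have : \sum_(v in part c (Some k)) (csize (F v z) + csize (F z v)) <=
    \sum_(v in part c (Some k)) ((full k (F v z) + full k (F z v)) + 2).
  (* Sizes and fullness are shifted together to use the triangle [v, s v, z]; fullness has already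
     been bounded by the insertion pairing. *)
  rewrite big_split [leqRHS]big_split [in leqRHS]big_split /=.
  rewrite -(sum_block_perm k (fun v => csize (F v z)) cov).
  rewrite -(sum_block_perm k (fun v => full k (F v z) : nat) cov) -!big_split /=.
  apply: leq_sum => v; rewrite inE => /eqP cv.
  by have [] := full_arc (rbF v (s v) z) (cover_full cov cv).
by rewrite [leqRHS]big_split /= sum_nat_const; lia.
Qed.

(** The linear term records the absence of loops; it yields the strictness needed when the rest is
    empty. *)
Lemma cross_self (V : finType) (F : V -> V -> cell) (k : 'I_3) (P : {set V}) :
  rainbow_free F -> cross F (csize_but k) P P + 4 * #|P| <= 4 * #|P| ^ 2.
Proof.
move=> [F0 _].
have : \sum_(u in P) (\sum_(v in P) (csize_but k (F u v) + csize_but k (F v u)) + 4)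
    <= 4 * #|P| * #|P|.
  apply: sum_leq_const => u Pu; rewrite (sum_setD1 _ Pu) F0.
  have cP := cardsD1 u P; rewrite Pu /= in cP.
  have : \sum_(v in P :\ u) (csize_but k (F u v) + csize_but k (F v u)) <= 4 * #|P :\ u|.
    apply: sum_leq_const => v _.
    have := csize_but_le k (F v u); have := csize_but_le k (F u v).
    by do 2!case: full; lia.
  have -> : csize_but k (false, false, false) = 0 by rewrite /csize_but.
  by lia.
by rewrite big_split /= sum_nat_const /cross; nia.
Qed.

Lemma cross_rest (V : finType) (F : V -> V -> cell) (s : {perm V}) c (k : 'I_3) :
  rainbow_free F -> maximal_cover F (s, c) ->
  cross F (csize_but k) (part c None) (part c None) <= 3 * #|part c None| ^ 2.
Proof.
move=> [F0 _] maxD; rewrite expnS expn1; apply: cross_le => z; rewrite inE => /eqP cz.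
apply: sum_leq_const => v; rewrite inE => /eqP cv.
have [->|nvz] := eqVneq v z; first by rewrite F0 /csize_but.
by rewrite no_digon_le3 ?(rest_no_digon maxD).
Qed.

(** * Density inside the rest *)

Definition pair_weight (V : finType) (F : V -> V -> cell) (u v : V) : nat :=
  weight (F u v) (F v u).

Lemma rest_path (V : finType) (F : V -> V -> cell) (s : {perm V}) c (x y z : V)
    (f := full_cell) :
  rainbow_free F -> maximal_cover F (s, c) ->
  x \in part c None -> y \in part c None -> z \in part c None ->
  pair_weight F x y = 2 -> pair_weight F y z = 2 ->
  [\/ pair_weight F x z = 0,
      pair_weight F x z = 1 /\
        [/\ F x y = f, F y z = f, F x z = f & (F y x != f) && (F z y != f)] |
      pair_weight F x z = 1 /\
        [/\ F y x = f, F z y = f, F z x = f & (F x y != f) && (F y z != f)]].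
Proof.
move=> [F0 rbF] maxD; rewrite !inE => /eqP cx /eqP cy /eqP cz wxy wyz.
have [->|nxz] := eqVneq x z; first by constructor 1; rewrite /pair_weight F0.
have nxy : x != y by apply/eqP => exy; move: wxy; rewrite exy /pair_weight F0.
have nyz : y != z by apply/eqP => eyz; move: wyz; rewrite eyz /pair_weight F0.
have -> : pair_weight F x z = weight (F z x) (F x z) by rewrite /pair_weight /weight addnC.
apply: weight2_path => //.
- by apply: (rest_no_circuit maxD); rewrite // eq_sym.
- by apply: (rest_no_circuit maxD); rewrite // eq_sym.
- exact: (rest_no_digon maxD).
- exact: (rest_no_digon maxD).
- by apply: (rest_no_digon maxD); rewrite // eq_sym.
Qed.

Lemma rest_pair_weight (V : finType) (F : V -> V -> cell) (s : {perm V}) c :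
  rainbow_free F -> maximal_cover F (s, c) ->
  3 * \sum_(u in part c None) \sum_(v in part c None) pair_weight F u v
    <= 4 * #|part c None| ^ 2.
Proof.
move=> rbF maxD; have F0 := rbF.1.
apply: weighted_turan.
- by move=> u v; rewrite /pair_weight /weight addnC.
- by move=> v; rewrite /pair_weight F0.
- move=> u v; rewrite !inE => /eqP cu /eqP cv.
  have [->|nuv] := eqVneq u v; first by rewrite /pair_weight F0.
  exact/weight_le2/(rest_no_digon maxD).
- move=> x y z Rx Ry Rz wxy wyz.
  by case: (rest_path rbF maxD Rx Ry Rz wxy wyz) => [->|[-> _]|[-> _]].
move=> x y z t Rx Ry Rz Rt wxy wyz wzt wtx wxz wyt.
(* Consecutive paths around [x, y, z, t] share a pair that is full in one direction only, so all are
   oriented in the same sense. Then [y, t] would be full in both directions, against [wyt]. *)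
have [|[_ [Fxy Fyz Fxz /andP[Fyx Fzy]]]|[_ [Fyx Fzy Fzx /andP[Fxy Fyz]]]] :=
  rest_path rbF maxD Rx Ry Rz wxy wyz; first by rewrite wxz.
- have wty : pair_weight F t y = 1 by rewrite -wyt /pair_weight /weight addnC.
  have [|[_ [_ _ Fty _]]|[_ [_ _ _ /andP[_]]]] := rest_path rbF maxD Rt Rx Ry wtx wxy.
  + by rewrite wty.
  + have [|[_ [_ _ Fyt _]]|[_ [_ _ _ /andP[]]]] := rest_path rbF maxD Ry Rz Rt wyz wzt.
    * by rewrite wyt.
    * by move: wyt; rewrite /pair_weight Fyt Fty.
    * by rewrite Fyz eqxx.
  + by rewrite Fxy eqxx.
- have wty : pair_weight F t y = 1 by rewrite -wyt /pair_weight /weight addnC.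
  have [|[_ [_ _ _ /andP[_]]]|[_ [_ _ Fyt _]]] := rest_path rbF maxD Rt Rx Ry wtx wxy.
  + by rewrite wty.
  + by rewrite Fyx eqxx.
  + have [|[_ [_ _ _ /andP[]]]|[_ [_ _ Fty _]]] := rest_path rbF maxD Ry Rz Rt wyz wzt.
    * by rewrite wyt.
    * by rewrite Fzy eqxx.
    * by move: wyt; rewrite /pair_weight Fyt Fty.
Qed.

(** Each of the [r (r - 1)] ordered pairs adds at most 2 to its weight, and
    [3 * 2 r (r - 1) + 4 r^2 = 10 r^2 - 6 r]. *)
Lemma cross_rest_size (V : finType) (F : V -> V -> cell) (s : {perm V}) c (r := #|part c None|) :
  rainbow_free F -> maximal_cover F (s, c) ->
  3 * cross F csize (part c None) (part c None) + 6 * r <= 10 * r ^ 2.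
Proof.
move=> rbF maxD; have F0 := rbF.1; have := rest_pair_weight rbF maxD.
set R := part c None in r *.
suff : cross F csize R R <=
    \sum_(u in R) (\sum_(v in R) pair_weight F u v + 2 * #|R|.-1).
  rewrite big_split sum_nat_const /= -/r expnS expn1.
  have [->|r_gt0] := posnP r; first lia.
  by rewrite -{3 6}(prednK r_gt0); nia.
apply: leq_sum => u Ru.
have cR := cardsD1 u R; rewrite Ru /= in cR.
rewrite (sum_setD1 _ Ru) [leqRHS]addnC (sum_setD1 _ Ru) F0 /= /pair_weight F0 /=.
rewrite cR /= mulnC -sum_nat_const -big_split /=.
by rewrite leq_sum // => v _; rewrite /weight; lia.
Qed.

(** * Upper bounds on the pair sums *)

Lemma card_parts (V : finType) (c : {ffun V -> option 'I_3}) (i j k : 'I_3) :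
  i != j -> j != k -> k != i ->
  #|V| = #|part c None| + #|part c (Some i)| + #|part c (Some j)| + #|part c (Some k)|.
Proof.
move=> nij njk nki; have := sum_part c (fun=> 1).
by rewrite sum1_card (sum_option_color _ nij njk nki) !sum1_card.
Qed.

Lemma cross_expand (V : finType) (F : V -> V -> cell) (c : {ffun V -> option 'I_3}) g
    (i j k : 'I_3) (C := fun p q => cross F g (part c p) (part c q)) :
  i != j -> j != k -> k != i ->
  2 * (\sum_u \sum_v g (F u v)) =
    C None None + 2 * (C (Some i) None + C (Some j) None + C (Some k) None)
    + C (Some i) (Some i) + C (Some j) (Some j) + C (Some k) (Some k)
    + 2 * (C (Some i) (Some j) + C (Some j) (Some k) + C (Some k) (Some i)).
Proof.
move=> nij njk nki; rewrite (cross_total F g c) !(sum_option_color _ nij njk nki) /C.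
rewrite (crossC F g (part c None) (part c (Some i))).
rewrite (crossC F g (part c None) (part c (Some j))).
rewrite (crossC F g (part c None) (part c (Some k))).
rewrite (crossC F g (part c (Some j)) (part c (Some i))).
rewrite (crossC F g (part c (Some k)) (part c (Some j))).
rewrite (crossC F g (part c (Some i)) (part c (Some k))).
lia.
Qed.

Lemma cross_sum (V : finType) (F : V -> V -> cell) (P Q : {set V}) (i j k : 'I_3) :
  i != j -> j != k -> k != i ->
  cross F (csize_but i) P Q + cross F (csize_but j) P Q + cross F (csize_but k) P Q
    = 2 * cross F csize P Q.
Proof.
move=> nij njk nki; rewrite /cross -!big_split big_distrr /=.
apply: eq_bigr => u _; rewrite -!big_split big_distrr /=; apply: eq_bigr => v _.
have := csize_but_sum (F u v) nij njk nki; have := csize_but_sum (F v u) nij njk nki.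
lia.
Qed.

Lemma cross_add_le (V : finType) (F : V -> V -> cell) (P Q : {set V}) (i j : 'I_3) :
  i != j ->
  cross F (csize_but i) P Q + cross F (csize_but j) P Q
    <= cross F csize P Q + 2 * (#|P| * #|Q|).
Proof.
move=> nij; rewrite /cross.
have -> : 2 * (#|P| * #|Q|) = \sum_(u in P) \sum_(v in Q) 2.
  by rewrite !sum_nat_const; lia.
rewrite -!big_split /=; apply: leq_sum => u _; rewrite -!big_split /=.
apply: leq_sum => v _.
have := csize_but_add_le (F u v) nij; have := csize_but_add_le (F v u) nij; lia.
Qed.

(** Against the baseline [2 * #|P| * #|Q|] per block, only three kinds of block may exceed: part [k]
    with itself (4), part [k] with the rest (3), and the rest with itself (3). *)
Lemma color_sum_le (V : finType) (F : V -> V -> cell) (s : {perm V}) c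
    (n := #|V|) (r := #|part c None|) (d := fun l => #|part c (Some l)|) (i j k : 'I_3) :
  rainbow_free F -> maximal_cover F (s, c) -> i != j -> j != k -> k != i ->
  2 * (\sum_u \sum_v csize_but k (F u v)) + 4 * d k
    <= 2 * n ^ 2 + 2 * d k ^ 2 + 2 * d k * r + r ^ 2.
Proof.
move=> rbF maxD nij njk nki; have [cov _] := maxD.
have nkj : k != j by rewrite eq_sym.
have := cross_expand F c (csize_but k) nij njk nki.
have oi Q := cross_block_other Q rbF cov nki.
have oj Q := cross_block_other Q rbF cov nkj.
have := cross_self k (part c (Some k)) rbF.
have := cross_rest k rbF maxD.
have := cross_block_rest k maxD.
have := oi (part c None); have := oi (part c (Some i)).
have := oi (part c (Some j)); have := oi (part c (Some k)).
have := oj (part c None); have := oj (part c (Some j)); have := oj (part c (Some k)).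
rewrite (crossC F _ (part c (Some k)) (part c (Some i))).
rewrite /n (card_parts c nij njk nki) -/r /d !expnS !expn0.
clear; lia.
Qed.

(** Inside the rest both sums are bounded jointly, by [10/3 r^2 + 2 r^2], which is [4/3 r^2] above
    the double baseline. *)
Lemma two_color_sums_le (V : finType) (F : V -> V -> cell) (s : {perm V}) c
    (n := #|V|) (r := #|part c None|) (d := fun l => #|part c (Some l)|)
    (E := fun l => \sum_u \sum_v csize_but l (F u v)) (i j k : 'I_3) :
  rainbow_free F -> maximal_cover F (s, c) -> i != j -> j != k -> k != i ->
  6 * (E i + E j) <= 12 * n ^ 2 + 6 * (d i ^ 2 + d j ^ 2 + (d i + d j) * r) + 4 * r ^ 2.
Proof.
move=> rbF maxD nij njk nki; have [cov _] := maxD.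
have nji : j != i by rewrite eq_sym.
have nik : i != k by rewrite eq_sym.
have := cross_expand F c (csize_but i) nij njk nki.
have := cross_expand F c (csize_but j) nij njk nki; rewrite -/(E i) -/(E j).
have ij Q := cross_block_other Q rbF cov nij.
have ik Q := cross_block_other Q rbF cov nik.
have ji Q := cross_block_other Q rbF cov nji.
have jk Q := cross_block_other Q rbF cov njk.
have := cross_self i (part c (Some i)) rbF; have := cross_self j (part c (Some j)) rbF.
have := cross_add_le F (part c None) (part c None) nij; have := cross_rest_size rbF maxD.
have := cross_block_rest i maxD; have := cross_block_rest j maxD.
have := ik (part c None); have := ij (part c None).
have := jk (part c None); have := ji (part c None).
have := ik (part c (Some k)); have := ij (part c (Some j)).
have := jk (part c (Some k)); have := ji (part c (Some i)).
have := ij (part c (Some i)); have := ik (part c (Some i)); have := ij (part c (Some k)).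
have := ji (part c (Some j)); have := jk (part c (Some j)); have := jk (part c (Some i)).
rewrite !(crossC F _ (part c (Some j)) (part c (Some i))).
rewrite !(crossC F _ (part c (Some k)) (part c (Some j))).
rewrite /n (card_parts c nij njk nki) -/r /d !expnS !expn0.
clear; lia.
Qed.

(** Every colour is counted twice, so a circuit part against the rest stays within the triple
    baseline [6 d r], and the rest exceeds its own by only [2/3 r^2 - 4 r]. *)
Lemma three_color_sums_le (V : finType) (F : V -> V -> cell) (s : {perm V}) c
    (n := #|V|) (r := #|part c None|) (d := fun l => #|part c (Some l)|)
    (E := fun l => \sum_u \sum_v csize_but l (F u v)) (i j k : 'I_3) :
  rainbow_free F -> maximal_cover F (s, c) -> i != j -> j != k -> k != i ->
  6 * (E i + E j + E k) + 12 * r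
    <= 18 * n ^ 2 + 6 * (d i ^ 2 + d j ^ 2 + d k ^ 2) + 2 * r ^ 2.
Proof.
move=> rbF maxD nij njk nki; have [cov _] := maxD.
have nji : j != i by rewrite eq_sym.
have nik : i != k by rewrite eq_sym.
have nkj : k != j by rewrite eq_sym.
have := cross_expand F c (csize_but i) nij njk nki.
have := cross_expand F c (csize_but j) nij njk nki.
have := cross_expand F c (csize_but k) nij njk nki; rewrite -/(E i) -/(E j) -/(E k).
have sum3 P Q := cross_sum F (part c P) (part c Q) nij njk nki.
have := sum3 None None; have := cross_rest_size rbF maxD.
have rest l := cross_block_rest_size l rbF maxD.
have := sum3 (Some i) None; have := sum3 (Some j) None; have := sum3 (Some k) None.
have := rest i; have := rest j; have := rest k.
have := cross_self i (part c (Some i)) rbF; have := cross_self j (part c (Some j)) rbF.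
have := cross_self k (part c (Some k)) rbF.
have ij Q := cross_block_other Q rbF cov nij.
have ik Q := cross_block_other Q rbF cov nik.
have ji Q := cross_block_other Q rbF cov nji.
have jk Q := cross_block_other Q rbF cov njk.
have ki Q := cross_block_other Q rbF cov nki.
have kj Q := cross_block_other Q rbF cov nkj.
have := ij (part c (Some j)); have := ik (part c (Some k)).
have := ji (part c (Some i)); have := jk (part c (Some k)).
have := ki (part c (Some i)); have := kj (part c (Some j)).
have := ij (part c (Some i)); have := ji (part c (Some j)).
have := ik (part c (Some i)); have := ki (part c (Some k)).
have := jk (part c (Some j)); have := kj (part c (Some k)).
have := ij (part c (Some k)); have := ki (part c (Some j)); have := jk (part c (Some i)).
rewrite !(crossC F _ (part c (Some j)) (part c (Some i))).
rewrite !(crossC F _ (part c (Some i)) (part c (Some k))).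
rewrite !(crossC F _ (part c (Some k)) (part c (Some j))).
rewrite /n (card_parts c nij njk nki) -/r /d !expnS !expn0.
clear; lia.
Qed.

(** * From digraphs to colour sets *)

Definition cell_of (V : finType) (G : 'I_3 -> digraph V) (u v : V) : cell :=
  ((u, v) \in edges (G ord0), (u, v) \in edges (G (lift ord0 ord0)), (u, v) \in edges (G ord_max)).

Lemma has_color_cell_of (V : finType) (G : 'I_3 -> digraph V) (k : 'I_3) u v :
  has_color k (cell_of G u v) = ((u, v) \in edges (G k)).
Proof.
by case: k => [[|[|[|//]]] lt3]; congr (_ \in edges (G _)); apply: val_inj.
Qed.

Lemma num_edges_sum (V : finType) (G : 'I_3 -> digraph V) (k : 'I_3) :
  num_edges (G k) = \sum_u \sum_v has_color k (cell_of G u v).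
Proof.
rewrite pair_big /= /num_edges -sum1_card big_mkcond /=.
by apply: eq_bigr => -[u v] _; rewrite has_color_cell_of; case: (_ \in _).
Qed.

Lemma rainbow_triangle_or_free (V : finType) (G : 'I_3 -> digraph V) :
  (exists (u v w : V) (a b d : 'I_3), rainbow_directed_triangle G u v w a b d)
  \/ rainbow_free (cell_of G).
Proof.
have loopless k v : ((v, v) \in edges (G k)) = false.
  exact/negbTE/edges_loopless.
have [/existsP[u /existsP[v /existsP[w]]]|nex] := boolP
  [exists u, exists v, exists w, ~~ rb_free (cell_of G u v) (cell_of G v w) (cell_of G w u)].
- have tri a b d : a != b -> b != d -> d != a -> (u, v) \in edges (G a) ->
      (v, w) \in edges (G b) -> (w, u) \in edges (G d) ->
      exists (u v w : V) (a b d : 'I_3), rainbow_directed_triangle G u v w a b d.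
    move=> nab nbd nda uv vw wu; exists u, v, w, a, b, d; split; split=> //; try exact/eqP.
    + by move=> e; rewrite e loopless in uv.
    + by move=> e; rewrite e loopless in vw.
    + by move=> e; rewrite e loopless in wu.
  rewrite /rb_free negbK => h; left; case/or4P: h => [||| /or3P[]] /and3P[]; exact: tri.
- right; split=> [v|u v w]; first by rewrite /cell_of !loopless.
  apply: contraNT nex => h.
  by apply/existsP; exists u; apply/existsP; exists v; apply/existsP; exists w.
Qed.

(** * Incompatibility of the inequalities on part sizes *)

Local Open Scope ring_scope.

Lemma sum_sqr_le (R : realDomainType) (x y z : R) : 0 <= x -> 0 <= y -> 0 <= z ->
  x ^+ 2 + y ^+ 2 + z ^+ 2 <= (x + y + z) ^+ 2.
Proof.
move=> x0 y0 z0.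
have := mulr_ge0 x0 y0; have := mulr_ge0 y0 z0; have := mulr_ge0 x0 z0.
lra.
Qed.

Lemma part_sizes_absurd (R : realFieldType) (d1 d2 d3 r : R) (n := d1 + d2 + d3 + r) :
  0 <= d1 -> 0 <= d2 -> 0 <= d3 -> 0 <= r -> 0 < n -> d1 <= d3 -> d2 <= d3 ->
  n ^+ 2 <= 9 * (d1 ^+ 2 - 2 * d1 + d1 * r + r ^+ 2 / 2) ->
  n ^+ 2 <= 9 * (d2 ^+ 2 - 2 * d2 + d2 * r + r ^+ 2 / 2) ->
  n ^+ 2 <= 9 * (d3 ^+ 2 - 2 * d3 + d3 * r + r ^+ 2 / 2) ->
  2 * n ^+ 2 <= 9 * (d1 ^+ 2 + d2 ^+ 2 + (d1 + d2) * r + 2 / 3 * r ^+ 2) ->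
  n ^+ 2 <= 3 * (d1 ^+ 2 + d2 ^+ 2 + d3 ^+ 2 + r ^+ 2 / 3 - 2 * r) ->
  False.
Proof.
move=> d1_ge0 d2_ge0 d3_ge0 r_ge0 n_gt0 le13 le23 h1 h2 h3 h12 hs.
have n_def : d3 = n - r - (d1 + d2) by rewrite /n; ring.
have [r_gt0|r_le0] := ltP 0 r; last first.
  have r0 : r = 0 by lra.
  rewrite r0 in h1 h2 h3 n_def.
  (* The term [- 2 * d] makes this strict; the three instances add up to [3 n < 3 n]. *)
  have big d : 0 <= d -> n ^+ 2 <= 9 * (d ^+ 2 - 2 * d + d * 0 + 0 ^+ 2 / 2) -> n < 3 * d.
    move=> d0 hd; rewrite ltNge; apply/negP => le3d.
    have : (3 * d) * (3 * d) <= n * n by apply: ler_pM => //; apply: mulr_ge0.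
    have : 0 < n * n by apply: mulr_gt0.
    have [d00|nd] := eqVneq d 0; first by rewrite d00 in hd *; lra.
    have : 0 < d by rewrite lt_def nd.
    lra.
  have := big _ d1_ge0 h1; have := big _ d2_ge0 h2; have := big _ d3_ge0 h3.
  by rewrite /n; lra.
have sqle : d1 ^+ 2 + d2 ^+ 2 + d3 ^+ 2 <= (n - r) * d3.
  have : 0 <= d1 * (d3 - d1) by apply: mulr_ge0; rewrite ?subr_ge0.
  have : 0 <= d2 * (d3 - d2) by apply: mulr_ge0; rewrite ?subr_ge0.
  rewrite /n; lra.
set p := d1 + d2 in n_def h12 *.
have p_ge0 : 0 <= p by rewrite /p; lra.
have nr : 0 <= n - r by rewrite /n; lra.
(* Bounding the squares in [hs] by [sqle] gives this product at least [6 r]. *)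
have hp : 0 < (n - r) * (2 * n - 4 * r - 3 * p) by rewrite n_def in sqle hs; lra.
have p_lt : 3 * p < 2 * n - 4 * r.
  rewrite ltNge; apply/negP => le.
  have : (n - r) * (2 * n - 4 * r - 3 * p) <= 0 by apply: mulr_ge0_le0 => //; lra.
  lra.
have sq12 : d1 ^+ 2 + d2 ^+ 2 <= p ^+ 2 by have := mulr_ge0 d1_ge0 d2_ge0; rewrite /p; lra.
have hpr : 2 * n ^+ 2 <= 9 * (p * (p + r)) + 6 * r ^+ 2 by lra.
have hpr2 : 9 * (p * (p + r)) <= (2 * n - 4 * r) * (2 * n - r).
  have -> : 9 * (p * (p + r)) = (3 * p) * (3 * p + 3 * r) by ring.
  by apply: ler_pM; lra.
(* The upper bound [p_lt] on [p] is set against the lower bound [hpr]; the outcome fails for [r]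
   between [n / 3] and [n / 2], while [p_lt] gives [r < n / 2]. *)
have quad : 0 <= n ^+ 2 - 5 * n * r + 5 * r ^+ 2 by lra.
have rr_gt0 : 0 < r * r by apply: mulr_gt0.
have r_le : 3 * r <= n.
  rewrite leNgt; apply/negP => lt.
  have : 0 < (3 * r - n) * (n - 2 * r) by apply: mulr_gt0; lra.
  lra.
have rn_ge0 : 0 <= r * (n - 3 * r) by apply: mulr_ge0; lra.
have low d : 0 <= d -> n ^+ 2 <= 9 * (d ^+ 2 - 2 * d + d * r + r ^+ 2 / 2) ->
    n / 3 - 3 / 4 * r <= d.
  move=> d0 hd; rewrite leNgt; apply/negP => lt.
  have : d * (d + r) <= (n / 3 - 3 / 4 * r) * (n / 3 + r / 4) by apply: ler_pM; lra.
  lra.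
have l1 := low _ d1_ge0 h1; have l2 := low _ d2_ge0 h2; have l3 := low _ d3_ge0 h3.
(* With every part at least [L] and the total fixed, the sum of squares is largest when two parts
   equal [L], leaving an excess [n - r - 3 L = 5 r / 4]. Then [hs] forces [2 n r <= 41/8 r^2 - 6 r],
   against [3 r <= n]. *)
pose L := n / 3 - 3 / 4 * r.
have : (d1 - L) ^+ 2 + (d2 - L) ^+ 2 + (d3 - L) ^+ 2 <= (n - r - 3 * L) ^+ 2.
  have -> : n - r - 3 * L = (d1 - L) + (d2 - L) + (d3 - L) by rewrite /n; ring.
  by apply: sum_sqr_le; rewrite subr_ge0.
have e : d1 ^+ 2 + d2 ^+ 2 + d3 ^+ 2 = (d1 - L) ^+ 2 + (d2 - L) ^+ 2 + (d3 - L) ^+ 2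
   + 2 * L * (n - r) - 3 * L ^+ 2 by rewrite /n; ring.
move=> h; rewrite e in hs.
have : n ^+ 2 <= 3 * ((n - r - 3 * L) ^+ 2 + 2 * L * (n - r) - 3 * L ^+ 2 + r ^+ 2 / 3 - 2 * r) by lra.
rewrite /L; lra.
Qed.

Lemma part_sizes_absurd_nat (d1 d2 d3 r : nat) (n := (d1 + d2 + d3 + r)%N) :
  (0 < n -> d1 <= d3 -> d2 <= d3 ->
  2 * n ^ 2 + 36 * d1 <= 18 * d1 ^ 2 + 18 * d1 * r + 9 * r ^ 2 ->
  2 * n ^ 2 + 36 * d2 <= 18 * d2 ^ 2 + 18 * d2 * r + 9 * r ^ 2 ->
  2 * n ^ 2 + 36 * d3 <= 18 * d3 ^ 2 + 18 * d3 * r + 9 * r ^ 2 ->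
  2 * n ^ 2 <= 9 * (d1 ^ 2 + d2 ^ 2 + (d1 + d2) * r) + 6 * r ^ 2 ->
  n ^ 2 + 6 * r <= 3 * (d1 ^ 2 + d2 ^ 2 + d3 ^ 2) + r ^ 2 -> False)%N.
Proof.
rewrite -!(ltr_nat rat) -!(ler_nat rat) !(natrD, natrM, natrX).
move=> n0 le13 le23 h1 h2 h3 h12 hs.
by apply: (@part_sizes_absurd rat d1%:R d2%:R d3%:R r%:R); rewrite ?ler0n //; lra.
Qed.

(** * Conclusion for dense triples of digraphs *)

Lemma rainbow_free_not_dense (V : finType) (F : V -> V -> cell) :
  rainbow_free F -> (0 < #|V|)%N ->
  (forall k : 'I_3, 10 * #|V| ^ 2 <= 9 * \sum_u \sum_v csize_but k (F u v))%N -> False.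
Proof.
move=> rbF V_gt0 dense; have [[s c] maxD] := maximal_cover_exists F.
(* Only the largest part has to be singled out, so the three cyclic orders of the colours
   suffice. *)
have ordered (i j k : 'I_3) : i != j -> j != k -> k != i ->
    (#|part c (Some i)| <= #|part c (Some k)| ->
     #|part c (Some j)| <= #|part c (Some k)| -> False)%N.
  move=> nij njk nki.
  have := color_sum_le rbF maxD nij njk nki; have := color_sum_le rbF maxD njk nki nij.
  have := color_sum_le rbF maxD nki nij njk; have := two_color_sums_le rbF maxD nij njk nki.
  have := three_color_sums_le rbF maxD nij njk nki.
  have := dense i; have := dense j; have := dense k; move: V_gt0 => /=.
  have -> : (#|V| = #|part c (Some i)| + #|part c (Some j)| + #|part c (Some k)|
      + #|part c None|)%N.
    by rewrite (card_parts c nij njk nki); lia.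
  move=> n_gt0 Ek Ej Ei b3 b2 bj bi bk leik lejk.
  apply: (part_sizes_absurd_nat n_gt0 leik lejk); lia.
pose a : 'I_3 := ord0; pose b : 'I_3 := lift ord0 ord0; pose e : 'I_3 := ord_max.
have := ordered a b e isT isT isT; have := ordered b e a isT isT isT.
have := ordered e a b isT isT isT; lia.
Qed.

Theorem theorem6 (n : nat) (n_gt0 : (0 < n)%N) (V : finType) (cardV : #|V| = n)
    (G : 'I_3 -> digraph V)
    (dense : forall i j : 'I_3, (i < j)%N ->
       (num_edges (G i))%:R + (num_edges (G j))%:R
         >= 10%:R / 9%:R * n%:R ^+ 2 :> rat) :
  exists (u v w : V) (a b d : 'I_3), rainbow_directed_triangle G u v w a b d.
Proof.
have [//|rbF] := rainbow_triangle_or_free G; exfalso.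
apply: (rainbow_free_not_dense rbF); rewrite cardV // => k.
(* Here [k] is the colour left out of the pair [i, j]. *)
have dense_nat (i j : 'I_3) : (i < j)%N -> k != i -> j != k ->
    (10 * n ^ 2 <= 9 * \sum_u \sum_v csize_but k (cell_of G u v))%N.
  move=> ltij nki njk; have nij : i != j by rewrite neq_ltn ltij.
  have -> : (\sum_u \sum_v csize_but k (cell_of G u v) = num_edges (G i) + num_edges (G j))%N.
    rewrite !num_edges_sum -big_split /=; apply: eq_bigr => u _.
    by rewrite -big_split /=; apply: eq_bigr => v _; apply: csize_but_has.
  have := dense i j ltij; rewrite -(ler_nat rat) !(natrM, natrX, natrD).
  lra.
case: k dense_nat => [[|[|[|//]]] lt3] dense_nat.
- exact: (dense_nat (lift ord0 ord0) ord_max).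
- exact: (dense_nat ord0 ord_max).
- exact: (dense_nat ord0 (lift ord0 ord0)).
Qed.
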